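(* Let $A\in\mathbb{R}^{n\times d}$, $y\in\mathbb{R}^n$, $\lambda>0$, let $g_1,\dots,g_k$ be a partition of $\{1,\dots,d\}$ with $|g_j|=p_j$, and let $C_j\in\mathbb{R}^{p_j\times p_j}$ be symmetric positive definite, $1\le j\le k$. For $\eta>0$ consider, on $\mathbb{R}^d\times\mathbb{R}^k_+$, $$\mathsf{J}(u,\theta):=\frac1{2n}\|y-Au\|_2^2+\frac{\lambda}{2\sqrt2}\|u\|_{D_\theta}^2+\frac{\lambda}{\sqrt2}\sum_{j=1}^k(\theta_j-\eta\log\theta_j),$$ where $D_\theta$ is the block-diagonal matrix with blocks $\theta_jC_j$ (on the indices $g_j$). Then: (1) $\mathsf{J}$ is strictly convex over $\mathbb{R}^d\times\mathbb{R}^k_+$ and admits a unique minimizer $(\hat u,\hat\theta)$. (2) For any initialization $\theta^0\in\mathbb{R}^k_+$, the iterates $u^\ell$ of the GS-IAS algorithm $$u^{\ell+1}:=\Bigl(\frac{A^TA}{n}+\frac{\lambda}{\sqrt2}D_{\theta^\ell}^{-1}\Bigr)^{-1}\frac{A^Ty}{n},\qquad \theta_j^{\ell+1}:=\frac\eta2+\sqrt{\frac{\eta^2}{4}+\frac{\|u^{\ell+1}_{g_j}\|_{C_j}^2}{2}},\quad 1\le j\le k,$$ converge at least linearly to $\hat u$ in the norm $\|\cdot\|_{D_{\hat\theta}}$. (3) $\hat u$ is the global minimizer over $\mathbb{R}^d$ of $\mathsf{F}(u):=\frac1{2n}\|y-Au\|_2^2+\lambda\mathsf{R}_\eta(u)$,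 where $$\mathsf{R}_\eta(u):=\frac1{\sqrt2}\sum_{j=1}^k\Bigl[\frac{\|u_{g_j}\|_{C_j}^2}{2f_j(u)}+f_j(u)-\eta\log f_j(u)\Bigr],\qquad f_j(u):=\frac\eta2+\sqrt{\frac{\eta^2}4+\frac{\|u_{g_j}\|_{C_j}^2}{2}}.$$
   Context: $\mathbb{R}^k_+=(0,\infty)^k$. For a symmetric positive definite matrix $C$, $\|x\|_C:=(x^TC^{-1}x)^{1/2}$ (Mahalanobis norm). $u_{g_j}\in\mathbb{R}^{p_j}$ denotes the subvector of $u$ with indices in $g_j$. ''Converge at least linearly to $\hat u$ in a norm $\|\cdot\|$'' means that $u^\ell\to\hat u$ and there exist $\rho\in(0,1)$ and $\ell_0$ such that $\|u^{\ell+1}-\hat u\|\le\rho\|u^\ell-\hat u\|$ for all $\ell\ge\ell_0$. *)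

(* Defs.v *)
From HB Require Import structures.
From mathcomp Require Import all_boot all_order all_algebra.
From mathcomp Require Import all_classical all_reals all_analysis.

Set Implicit Arguments.
Unset Strict Implicit.
Unset Printing Implicit Defensive.

Import Order.TTheory GRing.Theory Num.Theory.
Import numFieldNormedType.Exports.

Local Open Scope classical_set_scope.
Local Open Scope convex_scope.
Local Open Scope ring_scope.

Section Vectors.
Variable R : realType.

Definition sq_norm2 m (x : 'cV[R]_m) : R := \sum_(i < m) x i 0 ^+ 2.

Definition spd m (C : 'M[R]_m) : Prop :=
  C^T = C /\ forall x : 'cV[R]_m, x != 0 -> 0 < (x^T *m C *m x) 0 0.

Definition mahalanobis m (C : 'M[R]_m) (x : 'cV[R]_m) : R :=
  Num.sqrt ((x^T *m invmx C *m x) 0 0).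

Definition positive_orthant k : set 'cV[R]_k := [set t | forall j, 0 < t j 0].

Definition linear_convergence m (N : 'cV[R]_m -> R)
    (u : nat -> 'cV[R]_m) (uhat : 'cV[R]_m) : Prop :=
  u l @[l --> \oo] --> uhat /\
  exists (rho : R) (l0 : nat), 0 < rho < 1 /\
    forall l, (l0 <= l)%N -> N (u l.+1 - uhat) <= rho * N (u l - uhat).

End Vectors.

(* Strict counterpart of the library's [convex_function]; unlike the latter,
   the domain is also required to be convex. *)
Definition strictly_convex_function (R : numFieldType) (E : lmodType R)
    (E' := convex_lmodType E) (D : set E') (f : E' -> R^o) : Prop :=
  convex_set D /\
  forall t : {i01 R}, 0 < t%:num < 1 ->
    {in D &, forall x y : E', x != y -> (f (x <| t |> y) < f x <| t |> f y)%R}.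

Definition is_minimizer (R : realType) (T : Type) (D : set T) (f : T -> R)
    (x : T) : Prop :=
  D x /\ forall y, D y -> f x <= f y.

(* The parts are nonempty (the library's [partition] excludes [set0]), and
   injectivity of [g] makes parts of distinct index disjoint. *)
Definition is_indexed_partition d k (g : 'I_k -> {set 'I_d}) : Prop :=
  injective g /\ finset.partition (g @: [set: 'I_k])%SET [set: 'I_d]%SET.

Section Groups.
Variables (R : realType) (d k : nat) (g : 'I_k -> {set 'I_d}).
Implicit Types (u : 'cV[R]_d) (theta : 'cV[R]_k).
Implicit Types C : forall j : 'I_k, 'M[R]_#|g j|.

(* [enum_val] lists the indices of [g j] in increasing order. *)
Definition subvec u j : 'cV[R]_#|g j| :=
  rowsub (fun i : 'I_#|g j| => enum_val i) u.

(* The matrix of [subvec^~ j]. *)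
Definition restr_mx j : 'M[R]_(#|g j|, d) :=
  rowsub (fun i : 'I_#|g j| => enum_val i) 1%:M.

(* Block-diagonal up to the ordering of the indices: see [Dtheta_block] and
   [Dtheta_off_block]. *)
Definition Dtheta C theta : 'M[R]_d :=
  \sum_(j < k) theta j 0 *: ((restr_mx j)^T *m C j *m restr_mx j).

Definition f_opt C (eta : R) u j : R :=
  eta / 2 + Num.sqrt (eta ^+ 2 / 4 + mahalanobis (C j) (subvec u j) ^+ 2 / 2).

Definition R_eta C (eta : R) u : R :=
  (Num.sqrt 2)^-1 * \sum_(j < k)
    (mahalanobis (C j) (subvec u j) ^+ 2 / (2 * f_opt C eta u j)
     + f_opt C eta u j - eta * ln (f_opt C eta u j)).

Section Objective.
Variables (n : nat) (A : 'M[R]_(n, d)) (y : 'cV[R]_n) (lambda : R).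
Variables (C : forall j : 'I_k, 'M[R]_#|g j|) (eta : R).

Definition ias_J (p : 'cV[R]_d * 'cV[R]_k) : R :=
  (2 * n%:R)^-1 * sq_norm2 (y - A *m p.1)
  + lambda / (2 * Num.sqrt 2) * mahalanobis (Dtheta C p.2) p.1 ^+ 2
  + lambda / Num.sqrt 2 *
      \sum_(j < k) (p.2 j 0 - eta * ln (p.2 j 0)).

Definition ias_F u : R :=
  (2 * n%:R)^-1 * sq_norm2 (y - A *m u) + lambda * R_eta C eta u.

Definition u_update theta : 'cV[R]_d :=
  invmx (n%:R^-1 *: (A^T *m A)
         + (lambda / Num.sqrt 2) *: invmx (Dtheta C theta))
  *m (n%:R^-1 *: (A^T *m y)).

Definition theta_update u : 'cV[R]_k := \col_j f_opt C eta u j.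

Fixpoint gs_ias_theta (theta0 : 'cV[R]_k) (l : nat) : 'cV[R]_k :=
  if l is l'.+1 then theta_update (u_update (gs_ias_theta theta0 l'))
  else theta0.

(* The algorithm is initialized by theta alone, so the u-iterates start at
   index 1: [gs_ias_u theta0 l] is the iterate of index l + 1. *)
Definition gs_ias_u (theta0 : 'cV[R]_k) (l : nat) : 'cV[R]_d :=
  u_update (gs_ias_theta theta0 l).

End Objective.

Lemma restr_mxE u j : restr_mx j *m u = subvec u j.
Proof. by rewrite /restr_mx /subvec mul_rowsub_mx mul1mx. Qed.

Lemma mul_restr_mx_tr j : restr_mx j *m (restr_mx j)^T = 1%:M.
Proof.
apply/matrixP => r s; rewrite /restr_mx mul_rowsub_mx mul1mx !mxE.
by rewrite (inj_eq enum_val_inj) eq_sym.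
Qed.

Lemma mul_restr_mx_tr0 i j : is_indexed_partition g -> i != j ->
  restr_mx i *m (restr_mx j)^T = 0.
Proof.
move=> [gI /and3P[_ /finset.trivIsetP tI _]] nij.
apply/matrixP => r s; rewrite /restr_mx mul_rowsub_mx mul1mx !mxE.
case: eqP => // ers; have := enum_valP s; rewrite ers => rj.
have := tI (g i) (g j) (imset_f g (finset.in_setT i))
  (imset_f g (finset.in_setT j)) (contra_neq (@gI i j) nij).
by rewrite finset.disjoints_subset => /fintype.subsetP/(_ _ (enum_valP r)); rewrite inE rj.
Qed.

Lemma mxsub_restr_mx i j (M : 'M[R]_d) :
  mxsub (fun r : 'I_#|g i| => enum_val r) (fun s : 'I_#|g j| => enum_val s) M
  = restr_mx i *m M *m (restr_mx j)^T.
Proof.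
rewrite /restr_mx mul_rowsub_mx mul1mx trmx_mxsub trmx1 mulmx_colsub mulmx1.
by apply/matrixP => r s; rewrite !mxE.
Qed.

Lemma Dtheta_block C theta j : is_indexed_partition g ->
  mxsub (fun r : 'I_#|g j| => enum_val r) (fun s : 'I_#|g j| => enum_val s)
    (Dtheta C theta) = theta j 0 *: C j.
Proof.
move=> gP; rewrite mxsub_restr_mx mulmx_sumr mulmx_suml (bigD1 j) //= big1.
  rewrite addr0 -scalemxAr -scalemxAl !mulmxA mul_restr_mx_tr mul1mx.
  by rewrite -mulmxA mul_restr_mx_tr mulmx1.
move=> i nij; rewrite -scalemxAr -scalemxAl !mulmxA mul_restr_mx_tr0 1?eq_sym//.
by rewrite !mul0mx scaler0.
Qed.

Lemma Dtheta_off_block C theta i j : is_indexed_partition g -> i != j ->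
  mxsub (fun r : 'I_#|g i| => enum_val r) (fun s : 'I_#|g j| => enum_val s)
    (Dtheta C theta) = 0.
Proof.
move=> gP nij; rewrite mxsub_restr_mx mulmx_sumr mulmx_suml big1// => l _.
rewrite -scalemxAr -scalemxAl !mulmxA.
have [->|nil] := eqVneq l i; last first.
  by rewrite mul_restr_mx_tr0 1?eq_sym// !mul0mx scaler0.
by rewrite -(mulmxA _ (restr_mx i)) (mul_restr_mx_tr0 gP nij) mulmx0 scaler0.
Qed.

End Groups.

(* Main.v *)
(* Write J(u, t) = H(u, u)/2 - <b, u> + c sum_j (q_j(u)/(2 t_j) + t_j - eta ln t_j)
   up to a constant, where q_j(u) is the squared norm of the j-th block and
   c = lambda/sqrt 2.  The remainder of the first-order expansion of J at (u, t),
   evaluated at (u', t'), is exactly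
     H(u'-u, u'-u)/2 + c sum_j (q_j(u' - (t'_j/t_j) u)/(2 t'_j)
                                + eta (t'_j/t_j - 1 - ln (t'_j/t_j))),
   which is positive off the base point.  This gives strict convexity, the
   minimality of stationary points, the optimality of t_j = f_j(u), and the
   descent of the algorithm.  The map u |-> u_j/f_j(u) is strongly monotone
   where f is bounded, so the distance of two iterates is controlled by the sum
   of their energy decrements, which tends to 0: the iterates are Cauchy, and
   their limit is stationary.  Existence of the minimizer is obtained in this
   way, without compactness.
   Finally, subtracting the optimality systems of u^{l+1} and of the limit bounds
   the squared distance in the norm D_{t^l} by that of u^l with a factor that tends
   blockwise to (2(t_j - eta)/(2 t_j - eta))^2 < 1, t being the limit scale. *)
Require Import Defs.
From HB Require Import structures.
From mathcomp Require Import all_boot all_order all_algebra.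
From mathcomp Require Import all_classical all_reals all_analysis.
From mathcomp Require Import ring lra.
Set Implicit Arguments.
Unset Strict Implicit.
Unset Printing Implicit Defensive.
Import Order.TTheory GRing.Theory Num.Theory.
Import numFieldNormedType.Exports.
Local Open Scope classical_set_scope.
Local Open Scope ring_scope.

(** * Quadratic forms *)

Section BilinearForms.
Variable R : realType.

Definition mxdot m (M : 'M[R]_m) (x y : 'cV[R]_m) : R := (x^T *m M *m y) 0 0.

Definition psd m (M : 'M[R]_m) : Prop :=
  M^T = M /\ forall x, 0 <= mxdot M x x.

Section Form.
Variables (m : nat) (M : 'M[R]_m).
Implicit Types x y z : 'cV[R]_m.

Lemma mxdotDl x y z : mxdot M (x + y) z = mxdot M x z + mxdot M y z.
Proof. by rewrite /mxdot linearD /= !mulmxDl mxE. Qed.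

Lemma mxdotDr x y z : mxdot M x (y + z) = mxdot M x y + mxdot M x z.
Proof. by rewrite /mxdot mulmxDr mxE. Qed.

Lemma mxdotZl a x y : mxdot M (a *: x) y = a * mxdot M x y.
Proof. by rewrite /mxdot linearZ /= -!scalemxAl mxE. Qed.

Lemma mxdotZr a x y : mxdot M x (a *: y) = a * mxdot M x y.
Proof. by rewrite /mxdot -scalemxAr mxE. Qed.

Lemma mxdotNl x y : mxdot M (- x) y = - mxdot M x y.
Proof. by rewrite -scaleN1r mxdotZl mulN1r. Qed.

Lemma mxdotNr x y : mxdot M x (- y) = - mxdot M x y.
Proof. by rewrite -scaleN1r mxdotZr mulN1r. Qed.

Lemma mxdot0l x : mxdot M 0 x = 0.
Proof. by rewrite /mxdot linear0 !mul0mx mxE. Qed.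

Definition mxdotE := (mxdotDl, mxdotDr, mxdotNl, mxdotNr, mxdotZl, mxdotZr).

Lemma mxdotC x y : M^T = M -> mxdot M x y = mxdot M y x.
Proof.
move=> MT; rewrite /mxdot.
have -> : x^T *m M *m y = (y^T *m M *m x)^T by rewrite !trmx_mul trmxK MT mulmxA.
by rewrite !mxE.
Qed.

Lemma mxdot_sum x y : mxdot M x y = \sum_j (\sum_i x i 0 * M i j) * y j 0.
Proof.
rewrite /mxdot mxE; apply: eq_bigr => j _; rewrite mxE.
by congr (_ * _); apply: eq_bigr => i _; rewrite mxE.
Qed.

Lemma mxdot_sqr_le x y : psd M -> mxdot M x y ^+ 2 <= mxdot M x x * mxdot M y y.
Proof.
move=> [MT Mge0]; have := Mge0 y; rewrite le_eqVlt => /predU1P[y0|y_gt0].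
  rewrite -y0 mulr0; have [->|s0] := eqVneq (mxdot M x y) 0; first by rewrite expr0n.
  (* The coefficient makes the form take the value -1 at this vector. *)
  have := Mge0 (x - ((mxdot M x x + 1) / (2 * mxdot M x y)) *: y).
  rewrite !mxdotE -y0 (mxdotC y x MT) !(mulr0, subr0, oppr0).
  have -> : (mxdot M x x + 1) / (2 * mxdot M x y) * mxdot M x y = (mxdot M x x + 1) / 2.
    by field.
  by move: (mxdot M x x) => a h; lra.
have := Mge0 (mxdot M y y *: x - mxdot M x y *: y).
rewrite !mxdotE (mxdotC y x MT) => h.
rewrite -(ler_pM2l y_gt0); nra.
Qed.

End Form.

Lemma mxdot_mxZ m a (M : 'M[R]_m) x y : mxdot (a *: M) x y = a * mxdot M x y.
Proof. by rewrite /mxdot -scalemxAr -scalemxAl mxE. Qed.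

Lemma mxdot_mxD m (M N : 'M[R]_m) x y :
  mxdot (M + N) x y = mxdot M x y + mxdot N x y.
Proof. by rewrite /mxdot mulmxDr mulmxDl mxE. Qed.

Lemma mxdot_mx_sum m (I : finType) (M : I -> 'M[R]_m) x y :
  mxdot (\sum_i M i) x y = \sum_i mxdot (M i) x y.
Proof. by rewrite /mxdot mulmx_sumr mulmx_suml summxE. Qed.

Lemma mxdot_conj m p (P : 'M[R]_(m, p)) (M : 'M[R]_m) x y :
  mxdot (P^T *m M *m P) x y = mxdot M (P *m x) (P *m y).
Proof. by rewrite /mxdot trmx_mul !mulmxA. Qed.

Lemma psd_conj m p (P : 'M[R]_(m, p)) (M : 'M[R]_m) : psd M -> psd (P^T *m M *m P).
Proof.
move=> [MT Mge0]; split; first by rewrite !trmx_mul trmxK MT mulmxA.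
by move=> x; rewrite mxdot_conj.
Qed.

Lemma spd_unitmx m (M : 'M[R]_m) : spd M -> M \in unitmx.
Proof.
move=> [MT Mgt0]; rewrite -row_free_unit -kermx_eq0; apply/eqP/row_matrixP => i.
rewrite row0; apply/eqP; apply: contraT => v0.
have vM : row i (kermx M) *m M = 0 by apply/sub_kermxP; exact: row_sub.
have := Mgt0 (row i (kermx M))^T.
by rewrite -trmx0 (inj_eq trmx_inj) trmxK vM mul0mx mxE ltxx => /(_ v0).
Qed.

Lemma spd_psd m (M : 'M[R]_m) : spd M -> psd M.
Proof.
move=> [MT Mgt0]; split=> // x; have [->|/Mgt0/ltW//] := eqVneq x 0.
by rewrite mxdot0l.
Qed.

Lemma spd_invmx m (M : 'M[R]_m) : spd M -> spd (invmx M).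
Proof.
move=> Mspd; have Mu := spd_unitmx Mspd; have [MT Mgt0] := Mspd; split.
  by rewrite trmx_inv MT.
move=> x x0; have -> : x = M *m (invmx M *m x) by rewrite mulKVmx.
set z := invmx M *m x; rewrite trmx_mul MT -(mulmxA z^T) mulmxV // mulmx1 mulmxA.
by apply: Mgt0; apply: contra_neq x0 => z0; rewrite -(mulKVmx Mu x) -/z z0 mulmx0.
Qed.

(** The [i]-th coordinate is the [M]-product with [w i], so Cauchy-Schwarz bounds it. This later
    turns bounds on [\sum_j S j] into coordinatewise ones. *)
Lemma sqr_coord_le m (M : 'M[R]_m) : spd M ->
  exists K : R, 0 <= K /\ forall (x : 'cV[R]_m) i, x i 0 ^+ 2 <= K * mxdot M x x.
Proof.
move=> Mspd; have Mp := spd_psd Mspd; have Mu := spd_unitmx Mspd.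
have [MT _] := Mspd.
pose w i := invmx M *m (delta_mx i 0 : 'cV_m).
exists (\sum_i mxdot M (w i) (w i)); split.
  by apply: sumr_ge0 => i _; apply: Mp.2.
move=> x i; have -> : x i 0 = mxdot M (w i) x.
  rewrite mxdotC // /mxdot -mulmxA mulKVmx //.
  by rewrite -colE !mxE.
apply: le_trans (mxdot_sqr_le _ _ Mp) _; apply: ler_wpM2r; first exact: Mp.2.
by rewrite (bigD1 i) //= lerDl; apply: sumr_ge0 => j _; apply: Mp.2.
Qed.

End BilinearForms.

(** * The optimal scale of a block *)

Section ScalarFacts.
Variable R : realType.

Lemma ln_lt_subr1 (x : R) : 0 < x -> x != 1 -> ln x < x - 1.
Proof.
move=> x_gt0 x1; rewrite -ltr_expR lnK ?posrE //.
have := @expR_gt1Dx R (x - 1); rewrite subr_eq0 addrC subrK; exact.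
Qed.

Lemma ln_le_subr1 (x : R) : 0 < x -> ln x <= x - 1.
Proof.
move=> x_gt0; have [->|x1] := eqVneq x 1; first by rewrite ln1 subrr.
exact/ltW/ln_lt_subr1.
Qed.

(** The tangent of [ln] at [2 * eta]; half of the linear growth survives and makes the energy
    coercive in the scales. *)
Lemma half_le_log_barrier (eta t : R) : 0 < eta -> 0 < t ->
  t / 2 + (eta - eta * ln (2 * eta)) <= t - eta * ln t.
Proof.
move=> eta_gt0 t_gt0; have e2 : 0 < 2 * eta by rewrite mulr_gt0.
have /(ler_wpM2l (ltW eta_gt0)) := ln_le_subr1 (divr_gt0 t_gt0 e2).
rewrite ln_div ?posrE //.
have -> : eta * (t / (2 * eta) - 1) = t / 2 - eta by field; rewrite gt_eqF.
by rewrite mulrBr; lra.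
Qed.

Section OptimalScale.
Variables (eta : R) (eta_gt0 : 0 < eta).

Definition opt_scale (q : R) : R := eta / 2 + Num.sqrt (eta ^+ 2 / 4 + q / 2).

Lemma opt_scale_ge q : 0 <= q -> eta <= opt_scale q.
Proof.
move=> q0; rewrite /opt_scale.
have : Num.sqrt ((eta / 2) ^+ 2) <= Num.sqrt (eta ^+ 2 / 4 + q / 2).
  by apply: ler_wsqrtr; rewrite expr_div_n; nra.
rewrite sqrtr_sqr ger0_norm; last by rewrite divr_ge0 // ltW.
by lra.
Qed.

Lemma opt_scale_gt0 q : 0 <= q -> 0 < opt_scale q.
Proof. by move=> /opt_scale_ge; apply: lt_le_trans. Qed.

(** The scale is the larger root of [2 t (t - eta) = q]; most of the later algebra uses this form
    instead of the square root. *)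
Lemma opt_scale_eq q : 0 <= q -> q = 2 * opt_scale q * (opt_scale q - eta).
Proof.
move=> q0; rewrite /opt_scale.
have : Num.sqrt (eta ^+ 2 / 4 + q / 2) ^+ 2 = eta ^+ 2 / 4 + q / 2.
  by rewrite sqr_sqrtr //; nra.
by move: (Num.sqrt _) => s hs; nra.
Qed.

(** The left-hand side is the derivative of [q / (2 t) + t - eta ln t] at the optimal scale. *)
Lemma opt_scale_stationary q : 0 <= q ->
  1 - eta / opt_scale q - q / (2 * opt_scale q ^+ 2) = 0.
Proof.
move=> q0; have := opt_scale_eq q0; have := opt_scale_gt0 q0.
by move: (opt_scale q) => t t0 ->; field; rewrite gt_eqF.
Qed.

End OptimalScale.

End ScalarFacts.

Section Scales.
Variables (R : realType) (d : nat) (M : 'M[R]_d) (M_psd : psd M).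
Variables (eta : R) (eta_gt0 : 0 < eta).
Implicit Types u v : 'cV[R]_d.

Let t u := opt_scale eta (mxdot M u u).

Let q_ge0 u : 0 <= mxdot M u u. Proof. exact: M_psd.2. Qed.

(** Cauchy-Schwarz for [u - v] and [u + v], whose product is the difference of the squared norms, a
    polynomial in the two scales. *)
Lemma opt_scale_lipschitz u v :
  2 * (t u - t v) ^+ 2 * (t u + t v - eta) ^+ 2 <=
  mxdot M (u - v) (u - v) * ((t u + t v) * (t u + t v - 2 * eta)).
Proof.
have tu := opt_scale_ge eta_gt0 (q_ge0 u); have tv := opt_scale_ge eta_gt0 (q_ge0 v).
have eu := opt_scale_eq eta (q_ge0 u); have ev := opt_scale_eq eta (q_ge0 v).
rewrite -/(t u) -/(t v) in tu tv eu ev; clearbody t.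
have eta0 := eta_gt0.
have symM := mxdotC u v M_psd.1.
have hE : mxdot M (u - v) (u + v) = 2 * (t u - t v) * (t u + t v - eta).
  by rewrite !mxdotE -symM eu ev; ring.
have hP : mxdot M (u + v) (u + v) <= 2 * ((t u + t v) * (t u + t v - 2 * eta)).
  have cs := mxdot_sqr_le u v M_psd.
  (* The factors of the product of the squared norms are paired crosswise before AM-GM, so that the
     total depends on [t u + t v] only. *)
  have : mxdot M u v <= t u * (t v - eta) + t v * (t u - eta).
    set s := mxdot M u v in cs *.
    have x0 : 0 <= t u * (t v - eta) by apply: mulr_ge0; lra.
    have y0 : 0 <= t v * (t u - eta) by apply: mulr_ge0; lra.
    have s2 : s ^+ 2 <= 4 * (t u * (t v - eta)) * (t v * (t u - eta)).
      by apply: (le_trans cs); rewrite eu ev le_eqVlt; apply/orP; left; apply/eqP; ring.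
    rewrite leNgt; apply/negP => lt_s.
    move: s2 lt_s x0 y0; move: (t u * _) (t v * _) => x y s2 lt_s x0 y0.
    have : 0 < (s - (x + y)) * (s + (x + y)) by apply: mulr_gt0; lra.
    have := sqr_ge0 (x - y); lra.
  rewrite !mxdotE -symM eu ev; move: (mxdot M u v) => s; nra.
have cs := mxdot_sqr_le (u - v) (u + v) M_psd.
have := ler_wpM2l (q_ge0 (u - v)) hP.
by move=> /(le_trans cs); rewrite hE; move: (mxdot M (u - v) (u - v)) => Q; lra.
Qed.

(** The right-hand side has a closed form in which the varying scale costs a multiple of
    [(t u - t v) ^+ 2]; [opt_scale_lipschitz] bounds this cost. *)
Lemma scaled_strong_monotone u v :
  eta / (2 * t u * t v) * mxdot M (u - v) (u - v) <=
  mxdot M u (u - v) / t u - mxdot M v (u - v) / t v.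
Proof.
have tu := opt_scale_ge eta_gt0 (q_ge0 u); have tv := opt_scale_ge eta_gt0 (q_ge0 v).
have eu := opt_scale_eq eta (q_ge0 u); have ev := opt_scale_eq eta (q_ge0 v).
have lip := opt_scale_lipschitz u v; have e0 := q_ge0 (u - v).
rewrite -/(t u) -/(t v) in tu tv eu ev; clearbody t.
have eta0 := eta_gt0.
have symM := mxdotC u v M_psd.1.
have tu0 : 0 < t u by lra.
have tv0 : 0 < t v by lra.
have S0 : 0 < t u + t v - eta by lra.
set Q := mxdot M (u - v) (u - v) in lip e0 *.
have hid : mxdot M u (u - v) / t u - mxdot M v (u - v) / t v
    = (Q * (t u + t v) / 2 - (t u - t v) ^+ 2 * (t u + t v - eta)) / (t u * t v).
  rewrite /Q !mxdotE -symM eu ev; move: (mxdot M u v) => s.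
  by field; rewrite !gt_eqF.
have -> : eta / (2 * t u * t v) * Q = (eta / 2 * Q) / (t u * t v).
  by field; rewrite !gt_eqF.
rewrite {}hid ler_pM2r; last by rewrite invr_gt0 mulr_gt0.
rewrite -(ler_pM2r S0).
move: lip e0 tu tv; move: (t u) (t v) Q => a b Q lip e0 tu tv.
have : 0 <= Q * eta * (a + b - 2 * eta) by rewrite !mulr_ge0 //; lra.
have : 0 <= Q * eta ^+ 2 by rewrite mulr_ge0 // sqr_ge0.
nra.
Qed.

End Scales.

(** * Limits of sequences of vectors *)

Section Convergence.
Variable R : realType.

Lemma cvg_finsum (I : finType) (f : I -> nat -> R) (l : I -> R) :
  (forall i, f i @ \oo --> l i) ->
  (fun n => \sum_i f i n) @ \oo --> \sum_i l i.
Proof.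
move=> fl; elim: (index_enum I) => [|i r IHr].
  by under eq_fun do rewrite big_nil; rewrite big_nil; exact: cvg_cst.
by under eq_fun do rewrite big_cons; rewrite big_cons; exact: cvgD.
Qed.

Lemma cvg_cV d (x : nat -> 'cV[R]_d) (a : 'cV[R]_d) :
  (forall i, (fun n => x n i 0) @ \oo --> a i 0) -> x @ \oo --> a.
Proof.
move=> xa; apply/cvg_ballP => e e0.
have : \forall n \near \oo, forall i, ball (a i 0) e (x n i 0).
  by apply: filter_forall => i; move/cvg_ballP : (xa i); apply.
by apply: filterS => n xn; split=> // i j; rewrite (ord1 j).
Qed.

Lemma cvg_mxdot d (M : 'M[R]_d) (x y : nat -> 'cV[R]_d) (a b : 'cV[R]_d) :
  (forall i, (fun n => x n i 0) @ \oo --> a i 0) ->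
  (forall i, (fun n => y n i 0) @ \oo --> b i 0) ->
  (fun n => mxdot M (x n) (y n)) @ \oo --> mxdot M a b.
Proof.
move=> xa yb; rewrite mxdot_sum; under eq_fun do rewrite mxdot_sum.
apply: cvg_finsum => j; apply: cvgM => //; apply: cvg_finsum => i.
by apply: cvgM => //; exact: cvg_cst.
Qed.

(** Cauchy criterion: past some rank each [K * D n] is below half of [e ^+ 2]. *)
Lemma sqr_dist_is_cvg (x D : nat -> R) (K : R) : 0 <= K -> D @ \oo --> 0 ->
  (forall l m, (x l - x m) ^+ 2 <= K * (D l + D m)) -> cvgn x.
Proof.
move=> K0 D0 xD; apply: cauchy_cvg; apply: cauchy_exP => e e0.
have KD : (fun n => K * D n) @ \oo --> 0.
  by rewrite -[X in _ --> X](mulr0 K); apply: cvgM => //; exact: cvg_cst.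
have e2 : 0 < e ^+ 2 / 2 by rewrite divr_gt0 ?exprn_gt0.
have [N _ KDN] := @cvgr_lt _ _ _ _ _ _ KD _ e2.
exists (x N); exists N => // n /= Nn; rewrite /ball /=.
rewrite -(@ltr_pXn2r _ 2) ?nnegrE ?(ltW e0) //.
rewrite real_normK ?num_real //; apply: le_lt_trans (xD N n) _.
by have := KDN _ Nn; have := KDN N (leqnn N) => /=; lra.
Qed.

Lemma cvg_opt_scale (eta : R) (f : nat -> R) l :
  f @ \oo --> l -> (fun n => opt_scale eta (f n)) @ \oo --> opt_scale eta l.
Proof.
move=> fl; apply: cvgD; first exact: cvg_cst.
have h : (fun n => eta ^+ 2 / 4 + f n / 2) @ \oo --> eta ^+ 2 / 4 + l / 2.
  by apply: cvgD; [exact: cvg_cst|apply: cvgM => //; exact: cvg_cst].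
exact: (cvg_comp _ _ h (@sqrt_continuous R _)).
Qed.

End Convergence.

(** * The energy and its alternating minimization *)

Section Energy.
Variables (R : realType) (d k : nat).
Variables (H : 'M[R]_d) (b : 'cV[R]_d) (S : 'I_k -> 'M[R]_d) (c eta : R).
Hypotheses (H_psd : psd H) (S_psd : forall j, psd (S j)).
Hypotheses (S_spd : spd (\sum_j S j)) (c_gt0 : 0 < c) (eta_gt0 : 0 < eta).
Implicit Types (u v : 'cV[R]_d) (th t : 'cV[R]_k).

Let q_ge0 j u : 0 <= mxdot (S j) u u. Proof. exact: (S_psd j).2. Qed.

Definition energy u th : R :=
  mxdot H u u / 2 - mxdot 1%:M b u
  + c * \sum_j (mxdot (S j) u u / (2 * th j 0) + th j 0 - eta * ln (th j 0)).

(** The second differential of the energy in [u] at fixed scales; [energy_du] and [energy_diff] are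
    its partial and full first differentials. *)
Definition curvdot th u v : R :=
  mxdot H u v + c * \sum_j mxdot (S j) u v / th j 0.

Definition energy_du u th v : R := curvdot th u v - mxdot 1%:M b v.

Definition energy_diff u th v t : R :=
  energy_du u th v
  + c * \sum_j (1 - eta / th j 0 - mxdot (S j) u u / (2 * th j 0 ^+ 2)) * t j 0.

(* The quotients [th' j 0 / th j 0] and not [u' - u] appear in the quadratic
   terms because [q / th] is the perspective of a quadratic form. *)
Definition energy_rem u th u' th' : R :=
  mxdot H (u' - u) (u' - u) / 2
  + c * \sum_j
      (mxdot (S j) (u' - (th' j 0 / th j 0) *: u) (u' - (th' j 0 / th j 0) *: u)
         / (2 * th' j 0)
       + eta * (th' j 0 / th j 0 - 1 - ln (th' j 0 / th j 0))).

(** Block by block, the square is the remainder of the perspective [q / (2 t)] and the [ln] term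
    that of [- eta ln t]. *)
Lemma energy_expand u th u' th' : positive_orthant th -> positive_orthant th' ->
  energy u' th' =
  energy u th + energy_diff u th (u' - u) (th' - th) + energy_rem u th u' th'.
Proof.
move=> th0 th'0.
have sumE : \sum_j (mxdot (S j) u' u' / (2 * th' j 0) + th' j 0 - eta * ln (th' j 0))
  = \sum_j (mxdot (S j) u u / (2 * th j 0) + th j 0 - eta * ln (th j 0))
  + (\sum_j mxdot (S j) u (u' - u) / th j 0
     + \sum_j (1 - eta / th j 0 - mxdot (S j) u u / (2 * th j 0 ^+ 2)) * (th' - th) j 0)
  + \sum_j
      (mxdot (S j) (u' - (th' j 0 / th j 0) *: u) (u' - (th' j 0 / th j 0) *: u)
         / (2 * th' j 0)
       + eta * (th' j 0 / th j 0 - 1 - ln (th' j 0 / th j 0))).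
  rewrite -!big_split /=; apply: eq_bigr => j _.
  rewrite ln_div ?posrE // !mxdotE !mxE (mxdotC u' u (S_psd j).1).
  have := th0 j; have := th'0 j.
  move: (th j 0) (th' j 0) (ln _) (ln _) => t t' l l' t'_gt0 t_gt0.
  by field; rewrite !gt_eqF.
rewrite /energy sumE /energy_diff /energy_du /curvdot /energy_rem !mxdotE.
by rewrite (mxdotC u' u H_psd.1); field.
Qed.

Lemma energy_rem_ge0 u th u' th' : positive_orthant th -> positive_orthant th' ->
  0 <= energy_rem u th u' th'.
Proof.
move=> th0 th'0; apply: addr_ge0; first by rewrite divr_ge0 // H_psd.2.
apply/mulr_ge0/sumr_ge0 => [|j _]; first exact: ltW.
apply: addr_ge0; first by rewrite divr_ge0 // mulr_ge0 // ltW.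
by rewrite mulr_ge0 ?(ltW eta_gt0) // subr_ge0 ln_le_subr1 // divr_gt0.
Qed.

(** Each [S j] is only semidefinite and [H] may be degenerate: definiteness comes from the sum of
    the blocks. *)
Lemma sum_form_gt0 u : u != 0 -> exists j, 0 < mxdot (S j) u u.
Proof.
move=> /S_spd.2; rewrite -/(mxdot _ u u) mxdot_mx_sum => sum_gt0.
apply: contrapT => /forallNP S0; suff: \sum_j mxdot (S j) u u <= 0 by rewrite leNgt sum_gt0.
by apply: sumr_le0 => j _; rewrite leNgt; apply/negP/S0.
Qed.

Lemma energy_rem_gt0 u th u' th' : positive_orthant th -> positive_orthant th' ->
  (u', th') != (u, th) -> 0 < energy_rem u th u' th'.
Proof.
move=> th0 th'0; rewrite xpair_eqE negb_and => neq.
have Tge0 j : 0 <=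
    mxdot (S j) (u' - (th' j 0 / th j 0) *: u) (u' - (th' j 0 / th j 0) *: u)
      / (2 * th' j 0).
  by rewrite divr_ge0 // mulr_ge0 // ltW.
have Lge0 j : 0 <= eta * (th' j 0 / th j 0 - 1 - ln (th' j 0 / th j 0)).
  by rewrite mulr_ge0 ?(ltW eta_gt0) // subr_ge0 ln_le_subr1 // divr_gt0.
apply: ltr_wpDl; first by rewrite divr_ge0 // H_psd.2.
apply: mulr_gt0 => //.
suff [j j_gt0] : exists j, 0 <
    mxdot (S j) (u' - (th' j 0 / th j 0) *: u) (u' - (th' j 0 / th j 0) *: u)
      / (2 * th' j 0)
    + eta * (th' j 0 / th j 0 - 1 - ln (th' j 0 / th j 0)).
  rewrite (bigD1 j) //=; apply: ltr_pwDl => //; apply: sumr_ge0 => i _.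
  exact: addr_ge0.
(* A change of scale is seen by the [ln] term; at equal scales the ratio is 1 and the square is the
   form at [u' - u]. *)
have [Eth|] := eqVneq th' th; last first.
  move=> /eqP nth; have [j nj] : exists j, th' j 0 != th j 0.
    apply: contrapT => /forallNP h; apply: nth; apply/matrixP => j i.
    by rewrite (ord1 i); have /negP/negPn/eqP := h j.
  exists j; apply: ltr_wpDl => //; rewrite mulr_gt0 // subr_gt0.
  apply: ln_lt_subr1; first exact: divr_gt0.
  by apply: contra nj => /eqP h; rewrite -[th j 0]mul1r -h divfK // gt_eqF.
subst th'; move: neq; rewrite eqxx orbF -subr_eq0 => /sum_form_gt0[j qj].
by exists j; apply: ltr_pwDl => //; rewrite divff ?gt_eqF ?th0 // scale1r divr_gt0 // mulr_gt0.
Qed.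

(** * Optimal scales, stationary points and strict convexity *)

Definition opt_th u : 'cV[R]_k := \col_j opt_scale eta (mxdot (S j) u u).

Lemma opt_th_ge u j : eta <= opt_th u j 0.
Proof. by rewrite mxE; apply: opt_scale_ge. Qed.

Lemma opt_th_gt0 u : positive_orthant (opt_th u).
Proof. by move=> j; apply: lt_le_trans (opt_th_ge u j). Qed.

Lemma energy_diff_opt u v t : energy_diff u (opt_th u) v t = energy_du u (opt_th u) v.
Proof.
rewrite /energy_diff big1 ?mulr0 ?addr0 // => j _.
by rewrite mxE opt_scale_stationary ?mul0r.
Qed.

Lemma energy_du0 u th : energy_du u th 0 = 0.
Proof.
rewrite -[0](scale0r 0) /energy_du /curvdot !mxdotZr big1 ?mulr0 ?mul0r ?addr0 ?subrr // => j _.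
by rewrite mxdotZr !mul0r.
Qed.

Lemma energy_opt_le u th : positive_orthant th -> energy u (opt_th u) <= energy u th.
Proof.
move=> th0; rewrite (energy_expand u u (opt_th_gt0 u) th0) energy_diff_opt subrr energy_du0.
by rewrite addr0 lerDl energy_rem_ge0 //; apply: opt_th_gt0.
Qed.

(** By [energy_diff_opt], this says that [(u, opt_th u)] is a critical point of the energy. *)
Definition stationary u := forall v, energy_du u (opt_th u) v = 0.

Lemma stationary_lt u u' th : stationary u -> positive_orthant th ->
  (u', th) != (u, opt_th u) -> energy u (opt_th u) < energy u' th.
Proof.
move=> stu th0 neq; rewrite (energy_expand u u' (opt_th_gt0 u) th0) energy_diff_opt stu.
by rewrite addr0 ltrDl energy_rem_gt0 //; apply: opt_th_gt0.
Qed.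

(** Two distinct stationary points would each have strictly smaller energy than the other. *)
Lemma stationary_inj u u' : stationary u -> stationary u' -> u = u'.
Proof.
move=> su su'; apply: contrapT => /eqP neq.
have neq2 : (u', opt_th u') != (u, opt_th u) by rewrite xpair_eqE eq_sym (negPf neq).
have := stationary_lt su (opt_th_gt0 u') neq2; rewrite eq_sym in neq2.
by move=> /(lt_trans (stationary_lt su' (opt_th_gt0 u) neq2)); rewrite ltxx.
Qed.

Lemma energy_diff_linear u th a (x y : 'cV[R]_d) (s t : 'cV[R]_k) :
  energy_diff u th (a *: x + y) (a *: s + t) =
  a * energy_diff u th x s + energy_diff u th y t.
Proof.
rewrite /energy_diff /energy_du /curvdot.
have -> : \sum_j mxdot (S j) u (a *: x + y) / th j 0 =
  a * \sum_j mxdot (S j) u x / th j 0 + \sum_j mxdot (S j) u y / th j 0.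
  by rewrite mulr_sumr -big_split; apply: eq_bigr => j _ /=; rewrite !mxdotE; ring.
have -> : \sum_j (1 - eta / th j 0 - mxdot (S j) u u / (2 * th j 0 ^+ 2)) * (a *: s + t) j 0 =
  a * (\sum_j (1 - eta / th j 0 - mxdot (S j) u u / (2 * th j 0 ^+ 2)) * s j 0)
  + \sum_j (1 - eta / th j 0 - mxdot (S j) u u / (2 * th j 0 ^+ 2)) * t j 0.
  by rewrite mulr_sumr -big_split; apply: eq_bigr => j _; rewrite !mxE /=; ring.
by rewrite !mxdotE; ring.
Qed.

Lemma energy_strictly_convex (t : R) (x y : 'cV[R]_d) (r s : 'cV[R]_k) :
  0 < t < 1 -> positive_orthant r -> positive_orthant s -> (x, r) != (y, s) ->
  energy (t *: x + (1 - t) *: y) (t *: r + (1 - t) *: s) <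
  t * energy x r + (1 - t) * energy y s.
Proof.
move=> /andP[t0 t1] r0 s0 neq.
set z := t *: x + _; set w := t *: r + _.
have w0 : positive_orthant w.
  by move=> j; rewrite !mxE addr_gt0 // mulr_gt0 // subr_gt0.
rewrite (energy_expand z x w0 r0) (energy_expand z y w0 s0).
(* Both endpoints are expanded at [(z, w)]. Their increments are multiples of one vector, so the
   weighted first-order terms cancel; [+ 0] fits [energy_diff_linear]. *)
have -> : x - z = (1 - t) *: (x - y) + 0.
  by apply/matrixP => i j; rewrite !mxE; ring.
have -> : r - w = (1 - t) *: (r - s) + 0.
  by apply/matrixP => i j; rewrite !mxE; ring.
have -> : y - z = - t *: (x - y) + 0.
  by apply/matrixP => i j; rewrite !mxE; ring.
have -> : s - w = - t *: (r - s) + 0.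
  by apply/matrixP => i j; rewrite !mxE; ring.
have d0 : energy_diff z w 0 0 = 0.
  have := energy_diff_linear z w 1 0 0 0 0.
  by rewrite !scaler0 !addr0 mul1r; move: (energy_diff _ _ _ _) => D h; lra.
rewrite !energy_diff_linear d0.
have rx := energy_rem_ge0 z x w0 r0.
have ry := energy_rem_ge0 z y w0 s0.
have r_gt0 : 0 < t * energy_rem z w x r + (1 - t) * energy_rem z w y s.
  (* The endpoints differ, so at most one of them can be the base point and one remainder is
     positive. *)
  have [xz|xz] := eqVneq (x, r) (z, w); last first.
    by apply: ltr_pwDl; [exact/mulr_gt0/energy_rem_gt0|rewrite mulr_ge0 // subr_ge0 ltW].
  apply: ltr_wpDl; first by rewrite mulr_ge0 // ltW.
  apply: mulr_gt0; first by rewrite subr_gt0.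
  by apply: energy_rem_gt0 => //; rewrite -xz eq_sym.
move: r_gt0; move: (energy_rem _ _ _ _) (energy_rem _ _ _ _) => A B; lra.
Qed.

(** * Energy decrease and distance between iterates *)

Lemma curvdot_ge0 th u : positive_orthant th -> 0 <= curvdot th u u.
Proof.
move=> th0; apply: addr_ge0; first exact: H_psd.2.
apply: mulr_ge0; first exact: ltW.
by apply: sumr_ge0 => j _; rewrite divr_ge0 // ltW.
Qed.

(** At fixed scales the energy is quadratic in [u], so the expansion at its critical point [u'] is
    exact to second order. *)
Lemma energy_descent u u' th : positive_orthant th ->
  (forall v, energy_du u' th v = 0) ->
  energy u th = energy u' th + curvdot th (u - u') (u - u') / 2.
Proof.
move=> th0 su'; rewrite (energy_expand u' u th0 th0) /energy_diff su' subrr.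
rewrite big1 => [|j _]; last by rewrite mxE mulr0.
rewrite mulr0 !addr0; congr (_ + _); rewrite /energy_rem /curvdot mulrDl.
congr (_ + _); rewrite -mulrA mulr_suml; congr (_ * _); apply: eq_bigr => j _.
rewrite divff ?gt_eqF ?th0 // ln1 !subrr mulr0 addr0 scale1r.
by field; rewrite gt_eqF ?th0.
Qed.

Lemma energy_coercive K u th : positive_orthant th ->
  K <= mxdot H u u / 2 - mxdot 1%:M b u ->
  K + c * \sum_(j < k) (th j 0 / 2 + (eta - eta * ln (2 * eta))) <= energy u th.
Proof.
move=> th0 hK; apply: lerD => //; apply: ler_wpM2l; first exact: ltW.
apply: ler_sum => j _.
have := half_le_log_barrier eta_gt0 (th0 j).
have : 0 <= mxdot (S j) u u / (2 * th j 0) by rewrite divr_ge0 // mulr_ge0 // ltW.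
by lra.
Qed.

(** Young's inequality with a fixed weight on [H] and a free weight [a] on the blocks, to be matched
    with their small monotonicity constant. *)
Lemma curvdot_le th u v (a : R) : 0 < a -> (forall j, eta <= th j 0) ->
  curvdot th u v <= (1 + (2 * a)^-1) * curvdot th u u
    + (mxdot H v v / 4 + c * \sum_j (a / (2 * eta) * mxdot (S j) v v)).
Proof.
move=> a_gt0 th_ge.
have th0 j : 0 < th j 0 by apply: lt_le_trans (th_ge j).
have hH : mxdot H u v <= (1 + (2 * a)^-1) * mxdot H u u + mxdot H v v / 4.
  have p0 : 0 <= (2 * a)^-1 by rewrite invr_ge0 mulr_ge0 // ltW.
  have := mulr_ge0 p0 (H_psd.2 u).
  have := H_psd.2 (u - 2^-1 *: v); rewrite !mxdotE (mxdotC v u H_psd.1).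
  move: (2 * a)^-1 (mxdot H u u) (mxdot H u v) (mxdot H v v) => p x y z; lra.
rewrite /curvdot mulrDr addrACA; apply: lerD => //.
rewrite mulrCA -mulrDr; apply: ler_wpM2l; first exact: ltW.
rewrite mulr_sumr -big_split /=; apply: ler_sum => j _.
have hq : mxdot (S j) u v <= (2 * a)^-1 * mxdot (S j) u u + a / 2 * mxdot (S j) v v.
  have := q_ge0 j (u - a *: v); rewrite !mxdotE (mxdotC v u (S_psd j).1) => h.
  rewrite -(ler_pM2l a_gt0) mulrDr mulrA.
  have -> : a * (2 * a)^-1 = 2^-1 by field; rewrite gt_eqF.
  by lra.
have i0 : 0 < (th j 0)^-1 by rewrite invr_gt0.
have := ler_wpM2r (ltW i0) hq.
have : (th j 0)^-1 <= eta^-1 by rewrite lef_pV2 ?posrE.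
have -> : a / (2 * eta) * mxdot (S j) v v = eta^-1 * (a / 2 * mxdot (S j) v v).
  by field; rewrite gt_eqF.
have w0 : 0 <= a / 2 * mxdot (S j) v v by rewrite mulr_ge0 // divr_ge0 // ltW.
have u0 : 0 <= mxdot (S j) u u / th j 0 by rewrite divr_ge0 // ltW.
move=> /(ler_wpM2r w0) h1 h2.
rewrite [in leRHS]mulrDl mul1r; move: h1 h2 u0.
rewrite (mulrDl _ _ (th j 0)^-1) -(mulrA (2 * a)^-1).
rewrite (mulrC _ (th j 0)^-1 : a / 2 * _ * _ = _).
move: (mxdot _ u v / _) (eta^-1 * _) ((th j 0)^-1 * _) => p1 p2 p3.
by move: (mxdot _ u u / _) (_ * (mxdot (S j) u u / _)) => p4 p5; lra.
Qed.

(** [scaled_strong_monotone] summed over the blocks; the bound [M] makes its constant uniform, and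
    [b] cancels. *)
Lemma energy_du_strong_monotone u v M : (forall j, opt_th u j 0 <= M) ->
  (forall j, opt_th v j 0 <= M) ->
  mxdot H (u - v) (u - v)
    + c * \sum_j (eta / (2 * M ^+ 2) * mxdot (S j) (u - v) (u - v)) <=
  energy_du u (opt_th u) (u - v) - energy_du v (opt_th v) (u - v).
Proof.
move=> uM vM; rewrite /energy_du /curvdot.
have -> : forall x y z s t : R, x + c * s - y - (z + c * t - y) = x - z + c * (s - t).
  by move=> *; ring.
rewrite -mxdotNl -mxdotDl lerD2l; apply: ler_wpM2l; first exact: ltW.
rewrite -sumrB; apply: ler_sum => j _.
have := scaled_strong_monotone (S_psd j) eta_gt0 u v.
move: (uM j) (vM j) (opt_th_gt0 u j) (opt_th_gt0 v j); rewrite !mxE.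
move: (opt_scale _ _) (opt_scale _ _) => s t tM sM t0 s0; apply: le_trans.
apply: ler_wpM2r => //; apply: ler_wpM2l; first exact: ltW.
have M0 : 0 < M by apply: lt_le_trans sM.
have st0 : 0 < 2 * t * s by rewrite !mulr_gt0.
have MM0 : 0 < 2 * M ^+ 2 by rewrite mulr_gt0 ?exprn_gt0.
rewrite lef_pV2 ?posrE // -mulrA ler_pM2l // expr2.
by apply: ler_pM => //; exact: ltW.
Qed.

(** As [u1] and [v1] are the [u]-steps from [u] and [v], the derivatives at [u] and [v] are the
    curvature forms against [u - u1] and [v - v1]. Strong monotonicity and [curvdot_le] then
    conclude. *)
Lemma iterate_dist_le u u1 v v1 M : 0 < M ->
  (forall j, opt_th u j 0 <= M) -> (forall j, opt_th v j 0 <= M) ->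
  (forall w, energy_du u1 (opt_th u) w = 0) ->
  (forall w, energy_du v1 (opt_th v) w = 0) ->
  c * eta / (4 * M ^+ 2) * \sum_j mxdot (S j) (u - v) (u - v) <=
  (1 + (2 * (eta ^+ 2 / (4 * M ^+ 2)))^-1) *
  (curvdot (opt_th u) (u - u1) (u - u1) + curvdot (opt_th v) (v - v1) (v - v1)).
Proof.
move=> M0 uM vM su sv.
(* [a] makes the quadratic terms in [u - v] of both [curvdot_le] add up to half of
   the strong monotonicity constant. *)
set a := eta ^+ 2 / _.
have a0 : 0 < a by rewrite divr_gt0 ?mulr_gt0 ?exprn_gt0.
have := energy_du_strong_monotone uM vM.
have duE w w1 x th : (forall y, energy_du w1 th y = 0) ->
    energy_du w th x = curvdot th (w - w1) x.
  move=> /(_ x); rewrite /energy_du /curvdot mxdotDl mxdotNl => h.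
  have -> : \sum_j mxdot (S j) (w - w1) x / th j 0 =
      \sum_j mxdot (S j) w x / th j 0 - \sum_j mxdot (S j) w1 x / th j 0.
    by rewrite -sumrB; apply: eq_bigr => j _; rewrite !mxdotE mulrBl.
  by move: h; lra.
rewrite (duE _ _ _ _ su) (duE _ _ _ _ sv).
have hu := curvdot_le (u - u1) (u - v) a0 (opt_th_ge u).
(* This product enters with a minus sign, hence the argument [- (u - v)]. *)
have hv := curvdot_le (v - v1) (- (u - v)) a0 (opt_th_ge v).
have eN : curvdot (opt_th v) (v - v1) (- (u - v)) = - curvdot (opt_th v) (v - v1) (u - v).
  rewrite /curvdot mxdotNr [in RHS]opprD -[in RHS]mulrN -sumrN; congr (_ + _ * _).
  by apply: eq_bigr => j _; rewrite mxdotNr mulNr.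
have NN N : mxdot N (- (u - v)) (- (u - v)) = mxdot N (u - v) (u - v).
  by rewrite mxdotNl mxdotNr opprK.
have sN : \sum_j a / (2 * eta) * mxdot (S j) (- (u - v)) (- (u - v)) =
    \sum_j a / (2 * eta) * mxdot (S j) (u - v) (u - v).
  by apply: eq_bigr => j _; rewrite NN.
rewrite eN NN sN in hv.
rewrite -!mulr_sumr in hu hv *.
have h0 := H_psd.2 (u - v).
have -> : c * eta / (4 * M ^+ 2) * \sum_j mxdot (S j) (u - v) (u - v) =
  c * (eta / (2 * M ^+ 2) * \sum_j mxdot (S j) (u - v) (u - v))
  - 2 * (c * (a / (2 * eta) * \sum_j mxdot (S j) (u - v) (u - v))).
  by rewrite /a; field; rewrite !gt_eqF.
rewrite mulrDr; move: hu hv h0.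
move: (_ * curvdot _ _ _) (_ * curvdot _ _ _) (c * _) (c * _) (mxdot H _ _) => *; lra.
Qed.

(** * Contraction towards a stationary point *)

Definition contraction_rate (T t : R) : R :=
  (T - eta) * (t + T) * (t + T - 2 * eta) / ((t + T - eta) ^+ 2 * t).

(** Both optimality conditions are tested against [u' - uhat]. The linear term cancels, [H]
    contributes a favourable sign, and [lin] is the error made on [uhat] by using the scales of
    [u]. *)
Lemma step_contraction uhat u u' : stationary uhat ->
  (forall v, energy_du u' (opt_th u) v = 0) ->
  \sum_j mxdot (S j) (u' - uhat) (u' - uhat) / opt_th u j 0 <=
  \sum_j contraction_rate (opt_th uhat j 0) (opt_th u j 0)
    * (mxdot (S j) (u - uhat) (u - uhat) / opt_th uhat j 0).
Proof.
move=> suh su'; set e' := u' - uhat.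
pose lin j := mxdot (S j) uhat e' / opt_th uhat j 0 - mxdot (S j) uhat e' / opt_th u j 0.
have h1 : \sum_j mxdot (S j) e' e' / opt_th u j 0 <= \sum_j lin j.
  have := su' e'; have := suh e'; rewrite /energy_du /curvdot => h h'.
  have hs : \sum_j mxdot (S j) e' e' / opt_th u j 0 - \sum_j lin j =
    \sum_j mxdot (S j) u' e' / opt_th u j 0 - \sum_j mxdot (S j) uhat e' / opt_th uhat j 0.
    rewrite -!sumrB; apply: eq_bigr => j _.
    by rewrite {1}/e' mxdotDl mxdotNl /lin; ring.
  rewrite -subr_le0 hs -(ler_pM2l c_gt0) mulr0.
  have := H_psd.2 e'; rewrite {1}/e' mxdotDl mxdotNl; lra.
clearbody e'.
(* From [X <= L] and [L <= (X + Y) / 2] follows [X <= Y]. *)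
suff : \sum_j lin j <= (\sum_j mxdot (S j) e' e' / opt_th u j 0
   + \sum_j contraction_rate (opt_th uhat j 0) (opt_th u j 0)
      * (mxdot (S j) (u - uhat) (u - uhat) / opt_th uhat j 0)) / 2.
  by move: h1; lra.
rewrite -big_split /= mulr_suml; apply: ler_sum => j _; rewrite /lin.
have lip := opt_scale_lipschitz (S_psd j) eta_gt0 u uhat.
have eh := opt_scale_eq eta (q_ge0 j uhat).
move: (mxdot (S j) (u - uhat) _) lip => Q lip.
move: (opt_th_ge u j) (opt_th_ge uhat j); rewrite !mxE => tge Tge.
set t := opt_scale _ (mxdot _ u u) in lip tge *.
set T := opt_scale _ (mxdot _ uhat uhat) in lip Tge eh *.
have t0 : 0 < t by apply: lt_le_trans tge.
have T0 : 0 < T by apply: lt_le_trans Tge.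
(* AM-GM for [mxdot (S j) uhat e'], with weights chosen so that [e'] gets half
   of its share of the left-hand side. *)
have := q_ge0 j (e' - ((t - T) / T) *: uhat).
rewrite !mxdotE (mxdotC e' uhat (S_psd j).1) => h.
have i0 : 0 < (2 * t)^-1 by rewrite invr_gt0 mulr_gt0.
have := ler_wpM2l (ltW i0) h; rewrite mulr0 => {}h.
have hl : mxdot (S j) uhat e' / T - mxdot (S j) uhat e' / t <=
   mxdot (S j) e' e' / t / 2 + (t - T) ^+ 2 * (T - eta) / (t * T).
  rewrite -subr_ge0; apply: le_trans h _; rewrite le_eqVlt; apply/orP; left; apply/eqP.
  by rewrite eh; field; rewrite !gt_eqF.
apply: le_trans hl _; rewrite (mulrDl (_ / t)) lerD2l /contraction_rate.
have S0 : 0 < t + T - eta by have := eta_gt0; lra.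
(* This multiplier turns the bound on [(t - T) ^+ 2] into half of the contraction term. *)
have := ler_wpM2r (_ : 0 <= (T - eta) / (2 * (t + T - eta) ^+ 2 * t * T)) lip.
have -> : 0 <= (T - eta) / (2 * (t + T - eta) ^+ 2 * t * T).
  by rewrite divr_ge0 ?subr_ge0 // !mulr_ge0 ?sqr_ge0 //; exact: ltW.
move=> /(_ isT); congr (_ <= _); last by field; rewrite !gt_eqF.
by field; rewrite !gt_eqF.
Qed.

Lemma contraction_rate_lt1 (T : R) : eta <= T -> contraction_rate T T < 1.
Proof.
move=> T_ge; have eta0 := eta_gt0.
have T0 : 0 < T by lra.
have TT0 : 0 < T + T - eta by lra.
rewrite /contraction_rate ltr_pdivrMr; last by rewrite mulr_gt0 ?exprn_gt0.
(* The denominator minus the numerator, by the difference of squares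
   [(2 T - eta)^2 - 4 (T - eta)^2]. *)
have : 0 < T * (eta * (4 * T - 3 * eta)) by rewrite !mulr_gt0 //; lra.
by lra.
Qed.

Lemma cvg_energy_du (u : nat -> 'cV[R]_d) (th : nat -> 'cV[R]_k)
    (uhat : 'cV[R]_d) (that : 'cV[R]_k) v :
  positive_orthant that ->
  (forall i, (fun n => u n i 0) @ \oo --> uhat i 0) ->
  (forall j, (fun n => th n j 0) @ \oo --> that j 0) ->
  (fun n => energy_du (u n) (th n) v) @ \oo --> energy_du uhat that v.
Proof.
move=> that0 uu tt; have vv i : (fun n => v i 0) @ \oo --> v i 0 by exact: cvg_cst.
apply: cvgB; last exact: cvg_cst.
apply: cvgD; first exact: cvg_mxdot.
apply: cvgM; first exact: cvg_cst.
apply: cvg_finsum => j; apply: cvgM; first exact: cvg_mxdot.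
by apply: cvgV => //; rewrite gt_eqF.
Qed.

Lemma cvg_opt_th (u : nat -> 'cV[R]_d) (uhat : 'cV[R]_d) j :
  (forall i, (fun n => u n i 0) @ \oo --> uhat i 0) ->
  (fun n => opt_th (u n) j 0) @ \oo --> opt_th uhat j 0.
Proof.
move=> uu; rewrite mxE; under eq_fun do rewrite mxE.
by apply: cvg_opt_scale; exact: cvg_mxdot.
Qed.

(** * Convergence of the alternating minimization *)

Section Iterates.
Variable x : nat -> 'cV[R]_d.
Hypothesis xP : forall l v, energy_du (x l.+1) (opt_th (x l)) v = 0.
Variable K : R.
Hypothesis KP : forall u, K <= mxdot H u u / 2 - mxdot 1%:M b u.

(** The energy after a complete sweep; [D l] is twice the gain of the next [u]-step. *)
Let E l := energy (x l) (opt_th (x l)).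
Let D l := curvdot (opt_th (x l)) (x l - x l.+1) (x l - x l.+1).

Let E_descent l : E l.+1 + D l / 2 <= E l.
Proof.
rewrite /E (energy_descent (x l) (opt_th_gt0 (x l)) (xP l)) lerD2r.
by apply: energy_opt_le; apply: opt_th_gt0.
Qed.

Let D_ge0 l : 0 <= D l. Proof. by apply: curvdot_ge0; apply: opt_th_gt0. Qed.

Let E_nonincr : nonincreasing_seq E.
Proof.
by apply/nonincreasing_seqP => l; have := E_descent l; have := D_ge0 l; lra.
Qed.

Let B := c * \sum_(j < k) (eta - eta * ln (2 * eta)).

Let E_coercive l : K + c * (\sum_j opt_th (x l) j 0 / 2) + B <= E l.
Proof.
apply: le_trans (energy_coercive (opt_th_gt0 (x l)) (KP (x l))).
by rewrite big_split /= mulrDr addrA.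
Qed.

Let sum_opt_ge0 l : 0 <= \sum_j opt_th (x l) j 0 / 2.
Proof. by apply: sumr_ge0 => j _; rewrite divr_ge0 // ltW // opt_th_gt0. Qed.

Lemma iterates_bounded : exists M, 0 < M /\ forall l j, opt_th (x l) j 0 <= M.
Proof.
(* The initial energy bounds the sum of the half-scales; the absolute value and [+ 1] make [M]
   positive. *)
exists (`|2 * ((E 0%N - K - B) / c)| + 1); split; first by rewrite ltr_wpDl.
move=> l j; apply: le_trans (_ : 2 * ((E 0%N - K - B) / c) <= _); last first.
  by apply: le_trans (ler_norm _) _; rewrite lerDl.
have hE : E l <= E 0%N by apply: E_nonincr.
rewrite -ler_pdivrMl // mulrC; apply: le_trans (_ : \sum_j opt_th (x l) j 0 / 2 <= _).
  rewrite (bigD1 j) //= lerDl; apply: sumr_ge0 => i _.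
  by rewrite divr_ge0 // ltW // opt_th_gt0.
by rewrite ler_pdivlMr // mulrC; have := E_coercive l; lra.
Qed.

(** [D l] is at most twice the energy drop, and the energy converges, being nonincreasing and
    bounded below. *)
Lemma iterates_curv_cvg0 : D @ \oo --> 0.
Proof.
have cvgE : cvgn E.
  apply: nonincreasing_is_cvgn => //; exists (K + B) => _ [l _ <-].
  have := E_coercive l; have : 0 <= c * (\sum_j opt_th (x l) j 0 / 2).
    by rewrite mulr_ge0 ?sum_opt_ge0 // ltW.
  lra.
have EE : (fun l => 2 * (E l - E l.+1)) @ \oo --> 2 * (limn E - limn E).
  apply: cvgM; first exact: cvg_cst.
  by apply: cvgB => //; rewrite -[X in X @ _]/[sequence E n.+1]_n cvg_shiftS.
rewrite subrr mulr0 in EE.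
apply: (squeeze_cvgr _ (cvg_cst 0) EE).
by apply: nearW => l; rewrite D_ge0 /=; have := E_descent l; lra.
Qed.

Lemma iterates_cvg : exists uhat, stationary uhat /\
  forall i, (fun l => x l i 0) @ \oo --> uhat i 0.
Proof.
have [M [M0 xM]] := iterates_bounded.
have [K1 [K1_ge0 coordP]] := sqr_coord_le S_spd.
set C := 1 + (2 * (eta ^+ 2 / (4 * M ^+ 2)))^-1.
have kap0 : 0 < c * eta / (4 * M ^+ 2) by rewrite !(divr_gt0, mulr_gt0, exprn_gt0).
have C0 : 0 <= C.
  by rewrite addr_ge0 // invr_ge0 mulr_ge0 // divr_ge0 ?sqr_ge0 //
    mulr_ge0 // sqr_ge0.
have cvgx i : cvgn (fun l => x l i 0).
  (* [K1] passes from a coordinate to the summed form; the quotient comes from [iterate_dist_le]. *)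
  apply: (@sqr_dist_is_cvg _ _ D (K1 * (C / (c * eta / (4 * M ^+ 2))))) => [||l m].
  - by rewrite mulr_ge0 // divr_ge0 // ltW.
  - exact: iterates_curv_cvg0.
  - have := coordP (x l - x m) i; rewrite !mxE => h; apply: le_trans h _.
    rewrite -mulrA; apply: ler_wpM2l => //; rewrite mxdot_mx_sum.
    rewrite mulrAC ler_pdivlMr // mulrC.
    exact: iterate_dist_le.
exists (\col_i limn (fun l => x l i 0)).
have xu i : (fun l => x l i 0) @ \oo --> (\col_i limn (fun l => x l i 0)) i 0.
  by rewrite mxE; exact: cvgx.
split=> // v; set uhat := \col_i _ in xu *.
(* By [xP] this sequence is constantly 0, so its limit gives stationarity. *)
have h : (fun l => energy_du (x l.+1) (opt_th (x l)) v) @ \oo -->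
    energy_du uhat (opt_th uhat) v.
  apply: cvg_energy_du; first exact: opt_th_gt0.
    move=> i; rewrite -[X in X @ _]/[sequence (fun n => x n i 0) n.+1]_n.
    by rewrite (cvg_shiftS (fun n => x n i 0)).
  by move=> j; exact: cvg_opt_th.
apply: (@norm_cvg_unique _ _ _ _ _ _ h) => //.
by rewrite /=; under eq_fun do rewrite xP; exact: cvg_cst.
Qed.

Lemma iterates_contract uhat : stationary uhat ->
  (forall i, (fun l => x l i 0) @ \oo --> uhat i 0) ->
  exists (rho : R) (l0 : nat), 0 < rho < 1 /\ forall l, (l0 <= l)%N ->
    \sum_j mxdot (S j) (x l.+1 - uhat) (x l.+1 - uhat) / opt_th uhat j 0 <=
    rho ^+ 2 * \sum_j mxdot (S j) (x l - uhat) (x l - uhat) / opt_th uhat j 0.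
Proof.
move=> suh xu; pose T j := opt_th uhat j 0; pose t l j := opt_th (x l) j 0.
(* The base value 0 keeps [m] in [[0, 1)] even without blocks. *)
pose m := \big[Num.max/0]_j contraction_rate (T j) (T j).
have m1 : m < 1 by apply/bigmax_ltP; split=> // j _; apply/contraction_rate_lt1/opt_th_ge.
have m0 : 0 <= m by exact: bigmax_ge_id.
(* [tau] dominates the rates for large [l]; [kap], between [tau] and 1, pays for replacing the
   weights [t l j] by their limits [T j]. *)
pose tau := (1 + m) / 2; pose kap := (1 + tau) / 2.
have tau0 : 0 < tau by rewrite /tau; lra.
have tau1 : tau < 1 by rewrite /tau; lra.
have kap1 : kap < 1 by rewrite /kap; lra.
have tk : tau < kap by rewrite /kap; lra.
have kap0 : 0 < kap by lra.
have tT j : t^~ j @ \oo --> T j by exact: cvg_opt_th.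
have T0 j : 0 < T j by exact: opt_th_gt0.
have rateT j : (fun l => contraction_rate (T j) (t l j)) @ \oo -->
    contraction_rate (T j) (T j).
  have S0 : 0 < T j + T j - eta by have := opt_th_ge uhat j; have := T0 j; rewrite -/(T j); lra.
  rewrite /contraction_rate.
  apply: cvgM; first (apply: cvgM; first apply: cvgM; first exact: cvg_cst).
  - by apply: cvgD => //; exact: cvg_cst.
  - by apply: cvgB; [apply: cvgD => //; exact: cvg_cst|exact: cvg_cst].
  apply: cvgV; first by rewrite gt_eqF // mulr_gt0 // exprn_gt0.
  have sumT : (fun l => t l j + T j - eta) @ \oo --> T j + T j - eta.
    by apply: cvgB; [apply: cvgD => //; exact: cvg_cst|exact: cvg_cst].
  by apply: cvgM => //; exact: cvgM.
have near_rate : \forall l \near \oo, forall j, contraction_rate (T j) (t l j) < tau.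
  apply: filter_forall => j; apply: (@cvgr_lt _ _ _ _ _ _ (rateT j)).
  have : contraction_rate (T j) (T j) <= m by exact: le_bigmax.
  by rewrite /tau; lra.
have near_t : \forall l \near \oo, forall j, t l j < T j / kap.
  apply: filter_forall => j; apply: (@cvgr_lt _ _ _ _ _ _ (tT j)).
  by rewrite ltr_pdivlMr // gtr_pMr.
have [l0 _ l0P] : \forall l \near \oo, (forall j, contraction_rate (T j) (t l j) < tau)
    /\ (forall j, t l j < T j / kap).
  by apply: filterS2 near_rate near_t => l; split.
exists (Num.sqrt (tau / kap)), l0; split.
  rewrite sqrtr_gt0 divr_gt0 //= -[ltRHS]sqrtr1 ltr_sqrt //.
  by rewrite ltr_pdivrMr // mul1r.
move=> l /l0P /= [rl tl]; rewrite sqr_sqrtr; last by rewrite divr_ge0 // ltW.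
rewrite mulrAC ler_pdivlMr //.
apply: le_trans (_ : \sum_j mxdot (S j) (x l.+1 - uhat) (x l.+1 - uhat) / t l j <= _).
  rewrite mulr_suml; apply: ler_sum => j _; rewrite -mulrA; apply: ler_wpM2l => //.
  have t0 : 0 < t l j by exact: opt_th_gt0.
  have := tl j; rewrite ltr_pdivlMr // => h.
  rewrite mulrC ler_pdivrMr; last exact: T0.
  by rewrite [_ * opt_th _ _ _]mulrC ler_pdivlMr // mulrC ltW.
apply: le_trans (step_contraction suh (xP l)) _.
rewrite mulr_sumr; apply: ler_sum => j _; apply: ler_wpM2r; last exact/ltW/rl.
by rewrite divr_ge0 //; exact/ltW/T0.
Qed.

End Iterates.

End Energy.

(** * Specialization to the IAS functional *)

Section Restriction.
Variables (R : realType) (d k : nat) (g : 'I_k -> {set 'I_d}).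
Hypothesis g_part : is_indexed_partition g.
Variable C : forall j : 'I_k, 'M[R]_#|g j|.
Hypothesis C_spd : forall j, spd (C j).

Local Notation P := (restr_mx R g).

(** Block norms are carried to the whole space, so that groups of different sizes give matrices of
    one type. *)
Definition group_form j : 'M[R]_d := (P j)^T *m invmx (C j) *m P j.

Lemma group_form_psd j : psd (group_form j).
Proof. exact/psd_conj/spd_psd/spd_invmx. Qed.

Lemma sqr_mahalanobis m (M : 'M[R]_m) x : spd M ->
  mahalanobis M x ^+ 2 = mxdot (invmx M) x x.
Proof.
by move=> Mspd; rewrite sqr_sqrtr //; apply: (spd_psd (spd_invmx Mspd)).2.
Qed.

Lemma sqr_mahalanobis_subvec j u :
  mahalanobis (C j) (subvec g u j) ^+ 2 = mxdot (group_form j) u u.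
Proof. by rewrite sqr_mahalanobis // mxdot_conj restr_mxE. Qed.

(** The [j]-th term is diagonal with the indicator of [g j], and each index lies in exactly one
    group. *)
Lemma sum_restr_mx : \sum_j (P j)^T *m P j = 1%:M.
Proof.
apply/matrixP => i i'; rewrite summxE !mxE.
have [gI /and3P[/eqP cov /finset.trivIsetP triv _]] := g_part.
have : i \in finset.cover (g @: [set: 'I_k])%SET by rewrite cov inE.
case/finset.bigcupP => _ /finset.imsetP[j _ ->] ij.
have entry l : ((P l)^T *m P l) i i' = ((i \in g l) && (i == i'))%:R.
  rewrite mxE; have [il|nil] /= := boolP (i \in g l).
    rewrite (bigD1 (enum_rank_in il i)) //= big1 => [|r nr].
      by rewrite !mxE enum_rankK_in // eqxx mul1r addr0.
    rewrite !mxE; case: eqP => [e|]; last by rewrite mul0r.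
    by case/eqP: nr; apply: enum_val_inj; rewrite enum_rankK_in.
  rewrite big1 // => r _; rewrite !mxE; case: eqP => [e|]; last by rewrite mul0r.
  by have := enum_valP r; rewrite e (negPf nil).
rewrite (bigD1 j) //= entry ij /= big1 ?addr0 // => l nlj.
rewrite entry; case: (boolP (i \in g l)) => //= il.
have := triv (g l) (g j) (imset_f g (finset.in_setT l)) (imset_f g (finset.in_setT j)).
rewrite (inj_eq gI) => /(_ nlj); rewrite finset.disjoints_subset.
by move=> /fintype.subsetP/(_ _ il); rewrite inE ij.
Qed.

Lemma sum_group_form_spd : spd (\sum_j group_form j).
Proof.
split; first by rewrite linear_sum /=; apply: eq_bigr => j _; rewrite (group_form_psd j).1.
move=> u u0; rewrite -/(mxdot _ u u) mxdot_mx_sum.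
have [j Pj] : exists j, P j *m u != 0.
  apply: contrapT => /forallNP h; move/eqP: u0; apply.
  rewrite -(mul1mx u) -sum_restr_mx mulmx_suml big1 // => j _.
  by have /negP := h j; rewrite negbK -mulmxA => /eqP ->; rewrite mulmx0.
rewrite (bigD1 j) //=; apply: ltr_pwDl.
  by rewrite mxdot_conj; apply: (spd_invmx (C_spd j)).2.
by apply: sumr_ge0 => i _; apply: (group_form_psd i).2.
Qed.

(** Restrictions to distinct groups are orthogonal, so in the product with [Dtheta C theta] only
    diagonal terms remain and [sum_restr_mx] adds them up to the identity. *)
Lemma invmx_Dtheta theta : positive_orthant theta ->
  invmx (Dtheta C theta) = \sum_j (theta j 0)^-1 *: group_form j.
Proof.
move=> th0; set W := \sum_j _.
have DW : Dtheta C theta *m W = 1%:M.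
  rewrite -sum_restr_mx /Dtheta mulmx_suml; apply: eq_bigr => j _.
  rewrite mulmx_sumr (bigD1 j) //= big1 => [|i nij].
    rewrite addr0 -scalemxAr -scalemxAl scalerA mulVf ?gt_eqF ?th0 // scale1r.
    rewrite /group_form -!mulmxA (mulmxA (P j)) mul_restr_mx_tr mul1mx.
    by rewrite (mulmxA (C j)) mulmxV ?mul1mx ?spd_unitmx.
  rewrite -scalemxAr -scalemxAl /group_form -!mulmxA (mulmxA (P j)).
  by rewrite mul_restr_mx_tr0 1?eq_sym // !(mul0mx, mulmx0, scaler0).
have [Du _] := mulmx1_unit DW.
by rewrite -[LHS]mulmx1 -DW mulKmx.
Qed.

Lemma sqr_mahalanobis_Dtheta theta u : positive_orthant theta ->
  mahalanobis (Dtheta C theta) u ^+ 2 = \sum_j mxdot (group_form j) u u / theta j 0.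
Proof.
move=> th0; have E : mxdot (invmx (Dtheta C theta)) u u =
    \sum_j mxdot (group_form j) u u / theta j 0.
  rewrite invmx_Dtheta // mxdot_mx_sum; apply: eq_bigr => j _.
  by rewrite mxdot_mxZ mulrC.
rewrite sqr_sqrtr -/(mxdot _ u u) E //; apply: sumr_ge0 => j _.
by rewrite divr_ge0 ?(group_form_psd j).2 // ltW.
Qed.

End Restriction.

(** * The functionals [J] and [F] and the GS-IAS algorithm *)

Section Algorithm.
Variables (R : realType) (n d k : nat) (n_gt0 : (0 < n)%N).
Variables (A : 'M[R]_(n, d)) (y : 'cV[R]_n) (lambda : R) (lambda_gt0 : 0 < lambda).
Variables (g : 'I_k -> {set 'I_d}) (g_part : is_indexed_partition g).
Variables (C : forall j : 'I_k, 'M[R]_#|g j|) (C_spd : forall j, spd (C j)).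
Variables (eta : R) (eta_gt0 : 0 < eta).

Let H : 'M[R]_d := n%:R^-1 *: (A^T *m A).
Let b : 'cV[R]_d := n%:R^-1 *: (A^T *m y).
Let S := group_form C.
Let c : R := lambda / Num.sqrt 2.

Lemma sq_norm2_mxdot m (x : 'cV[R]_m) : sq_norm2 x = mxdot 1%:M x x.
Proof.
by rewrite /mxdot mulmx1 mxE; apply: eq_bigr => i _; rewrite mxE expr2.
Qed.

Let H_psd : psd H.
Proof.
split; first by rewrite linearZ /= trmx_mul trmxK.
move=> x; rewrite mxdot_mxZ mulr_ge0 ?invr_ge0 ?ler0n //.
rewrite -[A^T]mulmx1 mxdot_conj -sq_norm2_mxdot.
by apply: sumr_ge0 => i _; rewrite sqr_ge0.
Qed.

Let S_psd j : psd (S j). Proof. exact: group_form_psd. Qed.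

Let S_spd : spd (\sum_j S j). Proof. exact: sum_group_form_spd. Qed.

Let c_gt0 : 0 < c. Proof. by rewrite divr_gt0 // sqrtr_gt0. Qed.

Lemma residual_expand u : (2 * n%:R)^-1 * sq_norm2 (y - A *m u) =
  mxdot H u u / 2 - mxdot 1%:M b u + (2 * n%:R)^-1 * sq_norm2 y.
Proof.
have n0 : (n%:R : R) != 0 by rewrite pnatr_eq0 -lt0n.
have -> : mxdot H u u = n%:R^-1 * mxdot 1%:M (A *m u) (A *m u).
  by rewrite mxdot_mxZ -[A^T]mulmx1 mxdot_conj.
have -> : mxdot 1%:M b u = n%:R^-1 * mxdot 1%:M y (A *m u).
  rewrite mxdotZl; congr (_ * _); rewrite /mxdot trmx_mul trmxK !mulmx1.
  by rewrite mulmxA.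
rewrite !sq_norm2_mxdot !mxdotE (mxdotC (A *m u) y) ?trmx1 //.
by field.
Qed.

Lemma ias_JE u theta : positive_orthant theta ->
  ias_J A y lambda C eta (u, theta) =
  energy H b S c eta u theta + (2 * n%:R)^-1 * sq_norm2 y.
Proof.
move=> th0; rewrite /ias_J /= residual_expand sqr_mahalanobis_Dtheta //.
rewrite /energy -/c; have -> : lambda / (2 * Num.sqrt 2) = c / 2.
  by rewrite /c; field; rewrite gt_eqF // sqrtr_gt0.
have -> : \sum_j (mxdot (S j) u u / (2 * theta j 0) + theta j 0 - eta * ln (theta j 0)) =
   (\sum_j mxdot (group_form C j) u u / theta j 0) / 2
   + \sum_j (theta j 0 - eta * ln (theta j 0)).
  rewrite mulr_suml -big_split; apply: eq_bigr => j _ /=.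
  by rewrite -/S; field; rewrite gt_eqF ?th0.
by ring.
Qed.

Lemma theta_updateE u : theta_update C eta u = opt_th S eta u.
Proof.
apply/matrixP => j i; rewrite !mxE /f_opt /opt_scale.
by rewrite sqr_mahalanobis_subvec.
Qed.

(** As [opt_th S eta u] is the best scale for [u], this exhibits [F] as the partial minimum of [J]
    over the scales. *)
Lemma ias_FE u : ias_F A y lambda C eta u = ias_J A y lambda C eta (u, opt_th S eta u).
Proof.
have th0 := opt_th_gt0 S_psd eta_gt0 u.
rewrite ias_JE // /ias_F residual_expand /energy addrAC; congr (_ + _ + _).
rewrite /R_eta mulrA -/c; congr (_ * _); apply: eq_bigr => j _.
by rewrite sqr_mahalanobis_subvec // mxE /f_opt /opt_scale sqr_mahalanobis_subvec.
Qed.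

(** [W] is the matrix of [curvdot]. The block terms make it definite whatever the rank of [A], so
    [invmx] in the update is a true inverse. *)
Lemma u_updateP theta v : positive_orthant theta ->
  energy_du H b S c (u_update A y lambda C theta) theta v = 0.
Proof.
move=> th0; set W := H + c *: invmx (Dtheta C theta).
have WE x z : mxdot W x z = curvdot H S c theta x z.
  rewrite /W mxdot_mxD (mxdot_mxZ c) invmx_Dtheta // mxdot_mx_sum; congr (_ + _ * _).
  by apply: eq_bigr => j _; rewrite mxdot_mxZ mulrC.
have WT : W^T = W.
  rewrite /W invmx_Dtheta // linearD /= H_psd.1; congr (_ + _).
  rewrite linearZ /= linear_sum; congr (_ *: _).
  by apply: eq_bigr => j _; rewrite linearZ /= (S_psd j).1.
have Wspd : spd W.
  split=> // x x0; rewrite -/(mxdot W x x) WE /curvdot.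
  apply: ltr_wpDl; first exact: H_psd.2.
  have [j j0] := sum_form_gt0 S_spd x0.
  rewrite mulr_gt0 // (bigD1 j) //=; apply: ltr_pwDl; first by rewrite divr_gt0.
  by apply: sumr_ge0 => i _; rewrite divr_ge0 ?(S_psd i).2 // ltW.
rewrite /energy_du -WE; apply/eqP; rewrite subr_eq0; apply/eqP.
rewrite mxdotC // /mxdot -mulmxA /u_update -/H -/c -/W -/b mulKVmx ?spd_unitmx //.
by rewrite -[RHS]/(mxdot 1%:M b v) mxdotC ?trmx1 // /mxdot mulmx1.
Qed.

(** Nonnegativity of the residual; it supplies the bound [K] of the abstract iteration. *)
Lemma residual_form_bounded u :
  - ((2 * n%:R)^-1 * sq_norm2 y) <= mxdot H u u / 2 - mxdot 1%:M b u.
Proof.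
rewrite lerNl -subr_ge0 opprK addrC -residual_expand.
rewrite mulr_ge0 ?invr_ge0 ?mulr_ge0 // ?ler0n //.
by apply: sumr_ge0 => i _; rewrite sqr_ge0.
Qed.

Lemma gs_ias_theta_gt0 theta0 l : positive_orthant theta0 ->
  positive_orthant (gs_ias_theta A y lambda C eta theta0 l).
Proof. by case: l => //= l _; rewrite theta_updateE; apply: opt_th_gt0. Qed.

(** The scale used at index [l.+1] is the optimal one for the iterate of index [l], already at
    [l = 0]: this is hypothesis [xP]. *)
Lemma gs_ias_uP theta0 : positive_orthant theta0 -> forall l v,
  energy_du H b S c (gs_ias_u A y lambda C eta theta0 l.+1)
    (opt_th S eta (gs_ias_u A y lambda C eta theta0 l)) v = 0.
Proof.
move=> th0 l v; rewrite -theta_updateE; apply: u_updateP.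
exact: (gs_ias_theta_gt0 l.+1).
Qed.

Lemma gs_ias_limit theta0 : positive_orthant theta0 ->
  exists uhat, stationary H b S c eta uhat /\
    forall i, (fun l => gs_ias_u A y lambda C eta theta0 l i 0) @ \oo --> uhat i 0.
Proof.
move=> th0; apply: iterates_cvg => //; first exact: gs_ias_uP.
exact: residual_form_bounded.
Qed.

Lemma gs_ias_linear_convergence uhat theta0 : stationary H b S c eta uhat ->
  positive_orthant theta0 ->
  linear_convergence (mahalanobis (Dtheta C (opt_th S eta uhat)))
    (gs_ias_u A y lambda C eta theta0) uhat.
Proof.
move=> suh th0; have [u' [su' u'cvg]] := gs_ias_limit th0.
(* The limit depends a priori on [theta0]; uniqueness of stationary points identifies it. *)
have eu := stationary_inj H_psd S_psd S_spd c_gt0 eta_gt0 su' suh.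
rewrite eu in u'cvg; split; first exact: cvg_cV.
have [rho [l0 [rho01 contr]]] :=
  iterates_contract H_psd S_psd c_gt0 eta_gt0 (gs_ias_uP th0) suh u'cvg.
exists rho, l0; split=> // l /contr; have /andP[rho0 _] := rho01.
have that0 := opt_th_gt0 S_psd eta_gt0 uhat.
rewrite -!sqr_mahalanobis_Dtheta // -exprMn ler_pXn2r // nnegrE ?sqrtr_ge0 //.
by rewrite mulr_ge0 ?sqrtr_ge0 // ltW.
Qed.

Let dom : set ('cV[R]_d * 'cV[R]_k) := [set: 'cV[R]_d] `*` @positive_orthant R k.

Lemma ias_J_strictly_convex : strictly_convex_function dom (ias_J A y lambda C eta).
Proof.
have conv_gt0 (t : {i01 R}) (r s : 'cV[R]_k) : positive_orthant r ->
    positive_orthant s -> positive_orthant (t%:num *: r + (1 - t%:num) *: s).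
  move=> r0 s0 j; rewrite !mxE; have := r0 j; have := s0 j.
  have : 0 <= t%:num by [].
  have : t%:num <= 1 by [].
  move: (t%:num) (r j 0) (s j 0) => w p q w1 w0 q0 p0; nra.
split.
  move=> [x r] [y' s] t /set_mem[_ /= r0] /set_mem[_ /= s0].
  by apply/mem_set; split=> //=; exact: conv_gt0.
move=> t t01 [x r] [y' s] /set_mem[_ /= r0] /set_mem[_ /= s0] neq.
have lt_E :=
  energy_strictly_convex b H_psd S_psd S_spd c_gt0 eta_gt0 t01 r0 s0 neq.
set z := _ *: x + _ in lt_E; set w := _ *: r + _ in lt_E.
rewrite [X in (X < _)%R](_ : _ = ias_J A y lambda C eta (z, w)) //.
rewrite convRE !ias_JE //; last exact: conv_gt0.
by rewrite /unstable.onem; lra.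
Qed.

Lemma stationary_minimizer_J uhat : stationary H b S c eta uhat ->
  unique (is_minimizer dom (ias_J A y lambda C eta)) (uhat, opt_th S eta uhat).
Proof.
move=> suh; have that0 := opt_th_gt0 S_psd eta_gt0 uhat.
have lt_J p : dom p -> p != (uhat, opt_th S eta uhat) ->
    ias_J A y lambda C eta (uhat, opt_th S eta uhat) < ias_J A y lambda C eta p.
  case: p => u th [_ /= th0] neq; rewrite !ias_JE // ltrD2r.
  exact: stationary_lt.
split.
  split=> // p dp; have [->|/lt_J/ltW] := eqVneq p (uhat, opt_th S eta uhat); first by [].
  exact.
move=> p [dp pmin]; apply/esym/eqP/negPn/negP => /(lt_J _ dp).
by rewrite ltNge pmin.
Qed.

(** A minimizer [u] of [F] yields the minimizer [(u, opt_th S eta u)] of [J], so uniqueness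
    transfers from [J]. *)
Lemma stationary_minimizer_F uhat : stationary H b S c eta uhat ->
  unique (is_minimizer [set: 'cV[R]_d] (ias_F A y lambda C eta)) uhat.
Proof.
move=> /stationary_minimizer_J[[_ Jmin] Juniq].
have domS u : dom (u, opt_th S eta u) by split=> //=; apply: opt_th_gt0.
split; first by split=> // u _; rewrite !ias_FE; apply: Jmin.
move=> u [_ Fmin]; have /Juniq[->//] : is_minimizer dom (ias_J A y lambda C eta)
  (u, opt_th S eta u).
split=> // p dp; apply: le_trans (Jmin p dp).
by rewrite -!ias_FE; apply: Fmin.
Qed.

(** The limit of the algorithm started at unit scales. *)
Lemma stationary_exists : exists uhat, stationary H b S c eta uhat.
Proof.
have [|uhat [suh _]] := @gs_ias_limit (const_mx 1); last by exists uhat.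
by move=> j; rewrite mxE.
Qed.

End Algorithm.

Theorem theorem2p6 (R : realType) (n d k : nat) (n_gt0 : (0 < n)%N)
    (A : 'M[R]_(n, d)) (y : 'cV[R]_n) (lambda : R) (lambda_gt0 : 0 < lambda)
    (g : 'I_k -> {set 'I_d}) (g_part : is_indexed_partition g)
    (C : forall j : 'I_k, 'M[R]_#|g j|) (C_spd : forall j, spd (C j))
    (eta : R) (eta_gt0 : 0 < eta) :
  let dom : set ('cV[R]_d * 'cV[R]_k) := [set: 'cV[R]_d] `*` @positive_orthant R k in
  strictly_convex_function dom (ias_J A y lambda C eta) /\
  exists (uhat : 'cV[R]_d) (thetahat : 'cV[R]_k),
    [/\ unique (is_minimizer dom (ias_J A y lambda C eta)) (uhat, thetahat),
        forall theta0 : 'cV[R]_k, positive_orthant theta0 ->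
          linear_convergence (mahalanobis (Dtheta C thetahat))
            (gs_ias_u A y lambda C eta theta0) uhat
      & unique (is_minimizer [set: 'cV[R]_d] (ias_F A y lambda C eta)) uhat].
Proof.
move=> dom; split; first exact: ias_J_strictly_convex.
have [uhat suh] := stationary_exists n_gt0 A y lambda_gt0 g_part C_spd eta_gt0.
exists uhat, (opt_th (group_form C) eta uhat); split.
- exact: stationary_minimizer_J.
- by move=> theta0 th0; exact: gs_ias_linear_convergence.
- exact: stationary_minimizer_F.
Qed.
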